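(* Let $\mathcal{H},\mathcal{K}$ be complex Hilbert spaces, let $m<M$ be real numbers, let $A\in\mathcal{B}(\mathcal{H})$ be a self-adjoint operator with spectrum contained in $[m,M]$, and let $\Phi:\mathcal{B}(\mathcal{H})\to\mathcal{B}(\mathcal{K})$ be a positive unital linear map. Let $t\in(0,1)$ and let $f:[m,M]\to(0,\infty)$ be a continuous function such that $f^t$ is convex. Then $$\Phi(f(A))\le\Phi\left(\Big(\frac{M\mathbf{1}_{\mathcal{H}}-A}{M-m}f^t(m)+\frac{A-m\mathbf{1}_{\mathcal{H}}}{M-m}f^t(M)\Big)^{\frac1t}\right)\le\alpha f(\Phi(A)),$$ where $$\alpha=\max_{m\le s\le M}\left\{\frac{1}{f(s)}\Big(\frac{M-s}{M-m}f(m)+\frac{s-m}{M-m}f(M)\Big)\right\}.$$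
   Context: $\mathcal{B}(\mathcal{H})$ is the algebra of bounded linear operators on $\mathcal{H}$ and $\mathbf{1}_{\mathcal{H}}$ is the identity operator. For self-adjoint operators, $X\le Y$ means $Y-X$ is positive, i.e. $\langle Xx,x\rangle\le\langle Yx,x\rangle$ for all $x$. A linear map $\Phi$ is positive if it sends positive operators to positive operators, and unital if $\Phi(\mathbf{1}_{\mathcal{H}})=\mathbf{1}_{\mathcal{K}}$. Functions and powers of self-adjoint operators are defined by the continuous functional calculus; $f^t$ denotes the function $x\mapsto f(x)^t$. *)

(* Defs.v *)
From HB Require Import structures.
From mathcomp Require Import all_boot all_order all_algebra.
From mathcomp Require Import sesquilinear complex.
From mathcomp Require Import all_classical all_reals all_analysis.

Set Implicit Arguments.
Unset Strict Implicit.
Unset Printing Implicit Defensive.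
Import Order.TTheory GRing.Theory Num.Theory.
Import numFieldNormedType.Exports.
Local Open Scope classical_set_scope.
Local Open Scope ring_scope.
Local Open Scope complex_scope.

(* Complex Hilbert spaces; the inner product is linear in its first argument. *)
HB.mixin Record NormedModule_isHilbert (R : realType) (H : Type)
    & CompleteNormedModule R[i] H := {
  hdot : {dot H for (@Num.conj R[i])} ;
  hdot_norm : forall x : H, `|x| ^+ 2 = hdot x x
}.

#[short(type="hilbertType")]
HB.structure Definition Hilbert (R : realType) :=
  {H of NormedModule_isHilbert R H & CompleteNormedModule R[i] H}.

Section BoundedOperators.
Context {R : realType} (H : hilbertType R).

Definition bounded_operator (T : H -> H) : Prop :=
  linear T /\ exists c : R, forall x, `|T x| <= c%:C * `|x|.

Definition bop_pred : {pred H -> H} := fun T => `[< bounded_operator T >].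

Lemma bop_submod_closed : submod_closed bop_pred.
Proof.
split=> [|a S T /asboolP[Sl [b Sb]] /asboolP[Tl [c Tc]]]; apply/asboolP; split.
- by move=> k x y /=; rewrite scaler0 addr0.
- by exists 0 => x; rewrite normr0 mul0r.
- move=> k x y; rewrite -[LHS]/(a *: S (k *: x + y) + T (k *: x + y)).
  rewrite -[(a *: S + T) x]/(a *: S x + T x) -[(a *: S + T) y]/(a *: S y + T y).
  rewrite Sl Tl !scalerDr !scalerA (mulrC a k) -!addrA.
  by congr (_ + _); rewrite addrCA.
- have [r ar] : exists r : R, `|a| = r%:C.
    by exists (complex.Re `|a|); rewrite RRe_real ?normr_real.
  exists (r * b + c) => x; rewrite -[(a *: S + T) x]/(a *: S x + T x).
  have -> : (r * b + c)%:C = `|a| * b%:C + c%:C by rewrite ar rmorphD rmorphM.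
  rewrite mulrDl.
  apply: (le_trans (ler_normD _ _)); apply: lerD (Tc x).
  by rewrite normrZ -mulrA ler_wpM2l.
Qed.

HB.instance Definition _ :=
  GRing.isSubmodClosed.Build R[i] (H -> H) bop_pred bop_submod_closed.

Record bop := Bop { bop_fun :> H -> H ; bop_funP : bop_fun \in bop_pred }.

HB.instance Definition _ := [isSub for bop_fun].
HB.instance Definition _ := gen_eqMixin bop.
HB.instance Definition _ := gen_choiceMixin bop.
HB.instance Definition _ := [SubChoice_isSubLmodule of bop by <:].

Lemma bopP (S T : bop) : (forall x, S x = T x) -> S = T.
Proof. by move=> ST; apply/val_inj/funext. Qed.

Lemma bop_linear (T : bop) : linear T.
Proof. by have /asboolP[] := bop_funP T. Qed.

Lemma bop_bounded (T : bop) : exists c : R, forall x, `|T x| <= c%:C * `|x|.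
Proof. by have /asboolP[] := bop_funP T. Qed.

Fact bop_one_subproof : (id : H -> H) \in bop_pred.
Proof. by apply/asboolP; split=> //; exists 1 => x; rewrite mul1r. Qed.
Definition bop_one := Bop bop_one_subproof.

Fact bop_mul_subproof (S T : bop) : (S \o T) \in bop_pred.
Proof.
apply/asboolP; split=> [k x y /=|]; first by rewrite !bop_linear.
have [[b Sb] [c Tc]] := (bop_bounded S, bop_bounded T).
exists (Num.max 0 b * c) => x /=; rewrite rmorphM/= -mulrA.
apply: (le_trans (Sb _)).
have b0 : 0 <= (Num.max 0 b)%:C by rewrite lecR le_max lexx.
apply: (@le_trans _ _ ((Num.max 0 b)%:C * `|T x|)).
  by rewrite ler_wpM2r// lecR le_max lexx orbT.
by rewrite ler_wpM2l.
Qed.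
Definition bop_mul (S T : bop) := Bop (bop_mul_subproof S T).

Fact bop_mulA : associative bop_mul.
Proof. by move=> S T U; exact: bopP. Qed.
Fact bop_mul1l : left_id bop_one bop_mul.
Proof. by move=> S; exact: bopP. Qed.
Fact bop_mul1r : right_id bop_one bop_mul.
Proof. by move=> S; exact: bopP. Qed.
Fact bop_mulDl : left_distributive bop_mul +%R.
Proof. by move=> S T U; exact: bopP. Qed.
Fact bop_mulDr : right_distributive bop_mul +%R.
Proof.
move=> S T U; apply: bopP => x.
by have := bop_linear S 1 (T x) (U x); rewrite !scale1r.
Qed.

HB.instance Definition _ := GRing.Zmodule_isPzRing.Build bop
  bop_mulA bop_mul1l bop_mul1r bop_mulDl bop_mulDr.

Definition opnorm (T : bop) : R :=
  inf [set c : R | 0 <= c /\ forall x, `|T x| <= c%:C * `|x|].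

Definition selfadjoint (T : bop) : Prop :=
  forall x y, hdot (T x) y = hdot x (T y).

(* In the order of [R[i]], [0 <= z] means that [z] is real and nonnegative. *)
Definition positive_op (T : bop) : Prop := forall x, 0 <= hdot (T x) x.

Definition le_op (S T : bop) : Prop := positive_op (T - S).

Definition spectrum (T : bop) : set R[i] :=
  [set l | ~ exists S : bop, S * (T - l *: (1 : bop)) = 1 /\ (T - l *: (1 : bop)) * S = 1].

Definition op_horner (p : {poly R}) (T : bop) : bop :=
  \sum_(i < size p) (p`_i)%:C *: T ^+ i.

(* [B = f(A)]: [B] is the operator-norm limit of [p_n(A)] for real polynomials
   [p_n] converging to [f] uniformly on the spectrum of [A].  For [A]
   self-adjoint the spectrum is real, and for [f] continuous on it there is
   exactly one such [B]. *)
Definition is_cfc (A : bop) (f : R -> R) (B : bop) : Prop :=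
  exists p : nat -> {poly R},
    {uniform [set s : R | spectrum A s%:C],
       (fun n (s : R) => (p n).[s]) @ \oo --> f} /\
    opnorm (op_horner (p n) A - B) @[n --> \oo] --> (0 : R).

(* The default value [0] is irrelevant for [A] self-adjoint and [f] continuous
   on its spectrum. *)
Definition cfc (A : bop) (f : R -> R) : bop := xget 0 [set B | is_cfc A f B].

End BoundedOperators.

Definition positive_map (R : realType) (H K : hilbertType R)
    (Phi : bop H -> bop K) : Prop :=
  forall T, positive_op T -> positive_op (Phi T).

Definition unital_map (R : realType) (H K : hilbertType R)
    (Phi : bop H -> bop K) : Prop := Phi 1 = 1.

(* The maximum of a set of reals, when it has one. *)
Definition set_max (R : realType) (E : set R) : R :=
  xget 0 [set a | E a /\ ubound E a].

(* Main.v *)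
Require Import Defs.
From HB Require Import structures.
From mathcomp Require Import all_boot all_order all_algebra.
From mathcomp Require Import sesquilinear complex.
From mathcomp Require Import all_classical all_reals all_analysis.
From mathcomp Require Import ring lra.

Set Implicit Arguments.
Unset Strict Implicit.
Unset Printing Implicit Defensive.
Import Order.TTheory GRing.Theory Num.Theory.
Import numFieldNormedType.Exports.
Local Open Scope classical_set_scope.
Local Open Scope ring_scope.
Local Open Scope complex_scope.

(** Scalar inequalities on [[m, M]] transfer to operators: if [f <= g] on the
    spectrum of a self-adjoint [A], then [f(A) <= g(A)] ([is_cfc_le]).  Write
    [L] and [N] for the affine functions that agree at [m] and [M] with [f^t]
    and with [f] respectively, so that the operator [B] of the theorem is
    [L(A)] and [B^(1/t)] is [(L^(1/t))(A)] ([is_cfc_comp]).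

    Since [f^t] is convex, it lies below its chord, [f^t <= L]; raising to the
    power [1/t] gives [f <= L^(1/t)], hence [f(A) <= B^(1/t)], and the positive
    map [Phi] preserves this inequality.  Since [1/t >= 1], the power [1/t] is
    convex, and [L^(1/t) <= N] because [L(s)] is a convex combination of
    [f(m)^t] and [f(M)^t].  So [Phi(B^(1/t)) <= Phi(N(A))], and
    [Phi(N(A)) = N(Phi(A))] because [N] is affine and [Phi] linear and unital.
    Finally [m <= Phi(A) <= M], so that the spectrum of [Phi(A)] lies in
    [[m, M]], where [N <= alpha f] by the definition of [alpha]; therefore
    [N(Phi(A)) <= alpha f(Phi(A))].

    The rest of the file is the functional calculus used above.  Its core is
    [op_horner_ge0]: a real polynomial that is nonnegative on the spectrum of a
    self-adjoint operator [T] takes a positive value at [T].  Indeed, for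
    [l < 0] factor [p - l] over the complex numbers; none of its roots is in
    the spectrum of [T], which is real, so [p(T) - l] is a product of
    invertible operators; and a self-adjoint operator without negative
    spectrum is positive, because the infimum of its numerical range belongs to
    its spectrum ([positive_op_spectrum]).  The invertibility statements come
    from the Neumann series.  Applied to [c - p] and [c + p], the same result
    bounds the norm of [p(T)] by the supremum of [|p|] on the spectrum.
    Together with the completeness of the space of bounded operators and the
    Weierstrass theorem, proved here with Bernstein polynomials, this gives the
    existence of [f(T)].  Monotonicity passes to norm limits because the cone of
    positive operators is closed. *)

(** * The real inner product underlying a Hilbert space *)

Section Inner.
Context {R : realType} {H : hilbertType R}.
Implicit Types (x y z : H) (S T : bop H) (r c : R).

(** A symmetric real bilinear form: working with it instead of the sesquilinear
    one turns estimates on self-adjoint operators, for which [hdot (S x) x] is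
    real, into linear arithmetic over [R]. *)
Definition rdot x y : R := complex.Re (hdot x y).

(** The norm of [H] takes its values in [R[i]]; this is the same number in [R]. *)
Definition rnorm x : R := complex.Re `|x|.

Lemma hnormE x : `|x| = (rnorm x)%:C.
Proof. by rewrite /rnorm RRe_real// normr_real. Qed.

Lemma hdotC x y : hdot x y = (hdot y x)^*%C.
Proof. by rewrite hermC expr0 mul1r. Qed.

Lemma rdotC x y : rdot x y = rdot y x.
Proof. by rewrite /rdot hdotC; case: (hdot y x). Qed.

Lemma rdotDl x y z : rdot (x + y) z = rdot x z + rdot y z.
Proof. by rewrite /rdot linearDl raddfD. Qed.

Lemma rdotDr x y z : rdot z (x + y) = rdot z x + rdot z y.
Proof. by rewrite !(rdotC z) rdotDl. Qed.

Lemma rdotZl r x y : rdot (r%:C *: x) y = r * rdot x y.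
Proof. by rewrite /rdot linearZl_LR/=; case: (hdot x y) => a b /=; rewrite mul0r subr0. Qed.

Lemma rdotZr r x y : rdot x (r%:C *: y) = r * rdot x y.
Proof. by rewrite !(rdotC x) rdotZl. Qed.

Lemma rdotNl x y : rdot (- x) y = - rdot x y.
Proof. by rewrite /rdot linearNl raddfN. Qed.

Lemma rdotNr x y : rdot x (- y) = - rdot x y.
Proof. by rewrite !(rdotC x) rdotNl. Qed.

Lemma rdot_norm x : rdot x x = rnorm x ^+ 2.
Proof. by rewrite /rdot -hdot_norm hnormE -rmorphXn. Qed.

Lemma rnorm_ge0 x : 0 <= rnorm x.
Proof. by rewrite -lecR -hnormE; exact: normr_ge0. Qed.

Lemma rnorm_eq0 x : (rnorm x == 0) = (x == 0).
Proof. by rewrite -(normr_eq0 x) hnormE eq_complex /= eqxx andbT. Qed.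

Lemma rnorm0 : rnorm 0 = 0.
Proof. by apply/eqP; rewrite rnorm_eq0. Qed.

Lemma rnorm_gt0 x : (0 < rnorm x) = (x != 0).
Proof. by rewrite lt0r rnorm_ge0 andbT rnorm_eq0. Qed.

Lemma ler_rnormD x y : rnorm (x + y) <= rnorm x + rnorm y.
Proof. by rewrite -lecR rmorphD/= -!hnormE ler_normD. Qed.

Lemma rnormN x : rnorm (- x) = rnorm x.
Proof. by rewrite /rnorm normrN. Qed.

Lemma rnormZ r x : rnorm (r%:C *: x) = `|r| * rnorm x.
Proof.
apply: (@complexI R); rewrite -hnormE normrZ hnormE rmorphM.
by rewrite normc_def /= expr0n addr0 sqrtr_sqr.
Qed.

Lemma bopD S T x : (S + T) x = S x + T x. Proof. by []. Qed.
Lemma bopN S x : (- S) x = - S x. Proof. by []. Qed.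
Lemma bopB S T x : (S - T) x = S x - T x. Proof. by []. Qed.
Lemma bopZ (k : R[i]) S x : (k *: S) x = k *: S x. Proof. by []. Qed.
Lemma bopM S T x : (S * T) x = S (T x). Proof. by []. Qed.
Lemma bop1 x : (1 : bop H) x = x. Proof. by []. Qed.
Lemma bop0 x : (0 : bop H) x = 0. Proof. by []. Qed.

Definition bopE := (bopD, bopN, bopZ, bopM, bop1, bop0).

Lemma bop_appD S x y : S (x + y) = S x + S y.
Proof. by have := bop_linear S 1 x y; rewrite !scale1r. Qed.

Lemma bop_app0 S : S 0 = 0.
Proof. by apply: (addrI (S 0)); rewrite -bop_appD !addr0. Qed.

Lemma bop_appZ S (k : R[i]) x : S (k *: x) = k *: S x.
Proof. by have := bop_linear S k x 0; rewrite bop_app0 !addr0. Qed.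

Lemma bop_appN S x : S (- x) = - S x.
Proof. by rewrite -scaleN1r bop_appZ scaleN1r. Qed.

Lemma bop_scalerAl (k : R[i]) S T : k *: (S * T) = (k *: S) * T.
Proof. exact: bopP. Qed.

Lemma bop_scalerAr (k : R[i]) S T : k *: (S * T) = S * (k *: T).
Proof. by apply: bopP => x; rewrite !bopE bop_appZ. Qed.

(** * The operator norm *)

(** The bound given by [bop_bounded] may be negative when [H] is trivial, while
    the set defining [opnorm] has nonnegative elements only. *)
Lemma op_bound_max0 S c : (forall x, rnorm (S x) <= c * rnorm x) ->
  forall x, rnorm (S x) <= Num.max 0 c * rnorm x.
Proof.
move=> Sc x; apply: le_trans (Sc x) _.
by rewrite ler_wpM2r ?rnorm_ge0// le_max lexx orbT.
Qed.

Lemma op_bound_rnorm S c :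
  (forall x, `|S x| <= c%:C * `|x|) <-> (forall x, rnorm (S x) <= c * rnorm x).
Proof.
split=> + x => /(_ x); first by rewrite !hnormE -rmorphM lecR.
by rewrite -lecR rmorphM/= -!hnormE.
Qed.

Lemma opnorm_has_inf S :
  has_inf [set c : R | 0 <= c /\ forall x, `|S x| <= c%:C * `|x|].
Proof.
split; last by exists 0 => c [].
have [c /op_bound_rnorm/op_bound_max0 Sc] := bop_bounded S.
by exists (Num.max 0 c); split; [rewrite le_max lexx|apply/op_bound_rnorm].
Qed.

Lemma opnorm_ge0 S : 0 <= opnorm S.
Proof. by apply: lb_le_inf => [|c []//]; have [] := opnorm_has_inf S. Qed.

Lemma opnorm_le S c : 0 <= c -> (forall x, rnorm (S x) <= c * rnorm x) ->
  opnorm S <= c.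
Proof.
move=> c0 Sc; apply: ge_inf; first by have [] := opnorm_has_inf S.
by split=> //; apply/op_bound_rnorm.
Qed.

(** For [x != 0] every bound of [S] is at least the quotient of the norms of
    [S x] and [x], so the infimum of the bounds is again a bound. *)
Lemma opnormP S x : rnorm (S x) <= opnorm S * rnorm x.
Proof.
have [->|x0] := eqVneq x 0; first by rewrite bop_app0 rnorm0 mulr0.
have nx : 0 < rnorm x by rewrite rnorm_gt0.
rewrite -ler_pdivrMr//; apply: lb_le_inf; first by have [] := opnorm_has_inf S.
by move=> c [c0 /op_bound_rnorm/(_ x)]; rewrite ler_pdivrMr.
Qed.

Lemma opnormD S T : opnorm (S + T) <= opnorm S + opnorm T.
Proof.
apply: opnorm_le => [|x]; first by rewrite addr_ge0 ?opnorm_ge0.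
rewrite bopD mulrDl; apply: le_trans (ler_rnormD _ _) _.
by rewrite lerD ?opnormP.
Qed.

Lemma opnormM S T : opnorm (S * T) <= opnorm S * opnorm T.
Proof.
apply: opnorm_le => [|x]; first by rewrite mulr_ge0 ?opnorm_ge0.
rewrite bopM -mulrA; apply: le_trans (opnormP _ _) _.
by rewrite ler_wpM2l ?opnorm_ge0 ?opnormP.
Qed.

Lemma opnormN S : opnorm (- S) = opnorm S.
Proof.
have le T : opnorm (- T) <= opnorm T.
  by apply: opnorm_le => [|x]; rewrite ?opnorm_ge0// bopN rnormN opnormP.
by apply/le_anti; rewrite le/=; have := le (- S); rewrite opprK.
Qed.

Lemma opnormB S T : opnorm (S - T) = opnorm (T - S).
Proof. by rewrite -opnormN opprB. Qed.

Lemma opnormZ_le r S : opnorm (r%:C *: S) <= `|r| * opnorm S.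
Proof.
apply: opnorm_le => [|x]; first by rewrite mulr_ge0 ?opnorm_ge0.
by rewrite bopZ rnormZ -mulrA ler_wpM2l ?opnormP.
Qed.

Lemma opnorm0 : opnorm (0 : bop H) = 0.
Proof.
apply/le_anti; rewrite opnorm_ge0 andbT; apply: opnorm_le => // x.
by rewrite bop0 rnorm0 mul0r.
Qed.

Lemma opnorm1 : opnorm (1 : bop H) <= 1.
Proof. by apply: opnorm_le => // x; rewrite bop1 mul1r. Qed.


(** * Self-adjoint and positive operators *)
Lemma selfadjoint_rdot S x y : selfadjoint S -> rdot (S x) y = rdot x (S y).
Proof. by move=> Ss; rewrite /rdot Ss. Qed.

Lemma selfadjoint_real S x : selfadjoint S -> hdot (S x) x = (rdot (S x) x)%:C.
Proof.
move=> Ss; rewrite /rdot; have : hdot (S x) x = (hdot (S x) x)^*%C by rewrite {1}Ss hdotC.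
by case: (hdot (S x) x) => a b [/=] /eqP; rewrite -subr_eq0 opprK -mulr2n mulrn_eq0 => /eqP ->.
Qed.

Lemma selfadjoint1 : selfadjoint (1 : bop H). Proof. by []. Qed.

Lemma selfadjoint0 : selfadjoint (0 : bop H).
Proof. by move=> x y; rewrite !bop0 linear0l linear0r. Qed.

Lemma selfadjointD S T : selfadjoint S -> selfadjoint T -> selfadjoint (S + T).
Proof. by move=> Ss Ts x y; rewrite !bopD linearDl linearDr /= Ss Ts. Qed.

Lemma selfadjointZ r S : selfadjoint S -> selfadjoint (r%:C *: S).
Proof.
move=> Ss x y; rewrite !bopZ linearZl_LR linearZr_LR/= Ss.
congr (_ * _); exact: esym (conjc_real r).
Qed.

Lemma selfadjointN S : selfadjoint S -> selfadjoint (- S).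
Proof. by move=> Ss x y; rewrite !bopN linearNl linearNr /= Ss. Qed.

Lemma selfadjointX S n : selfadjoint S -> selfadjoint (S ^+ n).
Proof.
move=> Ss; elim: n => [|n IHn x y]; first exact: selfadjoint1.
by rewrite {1}exprS exprSr !bopM Ss IHn.
Qed.

Lemma selfadjoint_sum n (F : 'I_n -> bop H) :
  (forall i, selfadjoint (F i)) -> selfadjoint (\sum_(i < n) F i).
Proof.
move=> Fs; apply: big_ind => //; [exact: selfadjoint0|exact: selfadjointD].
Qed.

Lemma positive_selfadjoint S : selfadjoint S ->
  (positive_op S <-> forall x, 0 <= rdot (S x) x).
Proof. by move=> Ss; split=> P x; have := P x; rewrite selfadjoint_real// lecR. Qed.

(** Polarization: the values of the form at [x + y] and at [x + i y] determine
    [hdot (S x) y]. *)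
Lemma real_selfadjoint S :
  (forall x, complex.Im (hdot (S x) x) = 0) -> selfadjoint S.
Proof.
move=> Sr x y.
have e1 := Sr (x + y); have e2 := Sr (x + 'i%C *: y).
move: e1 e2 (Sr x) (Sr y); rewrite !bop_appD !bop_appZ !linearDl !linearDr /=.
rewrite !linearZl_LR !linearZr_LR /=.
rewrite (hdotC x (S y)).
case: (hdot (S x) x) => ? ?; case: (hdot (S y) y) => ? ?.
case: (hdot (S x) y) => a b; case: (hdot (S y) x) => c d /=.
move=> e1 e2 e3 e4; apply/eqP; rewrite eq_complex /=; apply/andP; split; apply/eqP; lra.
Qed.

Lemma positive_op_selfadjoint S : positive_op S -> selfadjoint S.
Proof.
by move=> Sp; apply: real_selfadjoint => x; have := Sp x; rewrite lecE => /andP[/eqP].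
Qed.

End Inner.

Section Operators.
Context {R : realType} {H : hilbertType R}.
Implicit Types (x y z : H) (S T : bop H) (r c e : R).

(** Cauchy-Schwarz, by expanding the square of the norm of
    [(rnorm v) u - (rnorm u) v]. *)
Lemma rdot_le x y : `|rdot x y| <= rnorm x * rnorm y.
Proof.
have half u v : rdot u v <= rnorm u * rnorm v.
  have [->|u0] := eqVneq u 0.
    by rewrite rnorm0 mul0r /rdot linear0l.
  have [->|v0] := eqVneq v 0.
    by rewrite rnorm0 mulr0 /rdot linear0r.
  have : 0 <= rnorm ((rnorm v)%:C *: u - (rnorm u)%:C *: v) ^+ 2 by rewrite sqr_ge0.
  rewrite -rdot_norm rdotDl !rdotDr !rdotNl !rdotNr !rdotZl !rdotZr.
  rewrite (rdotC v u) !rdot_norm.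
  have u1 : 0 < rnorm u by rewrite rnorm_gt0.
  have v1 : 0 < rnorm v by rewrite rnorm_gt0.
  move: (rnorm u) (rnorm v) (rdot u v) u1 v1 => a b d a0 b0 e0.
  rewrite -(ler_pM2l (mulr_gt0 a0 b0)); nra.
by rewrite ler_norml half andbT lerNl -rdotNl -(rnormN x) half.
Qed.

Lemma rdot_op_le S x y : `|rdot (S x) y| <= opnorm S * rnorm x * rnorm y.
Proof.
by apply: le_trans (rdot_le _ _) _; rewrite ler_wpM2r ?rnorm_ge0 ?opnormP.
Qed.

(** Applied to [i y] instead of [y], symmetry for the real form also compares the
    imaginary parts. *)
Lemma rdot_selfadjoint S : (forall x y, rdot (S x) y = rdot x (S y)) -> selfadjoint S.
Proof.
move=> Ss x y; have Re_eq := Ss x y; have Im_eq := Ss x ('i%C *: y).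
move: Re_eq Im_eq; rewrite /rdot bop_appZ !linearZr_LR /=.
case: (hdot (S x) y) (hdot x (S y)) => a b [c d] /= ac bd.
by congr (_ +i* _)%C; lra.
Qed.

(** This lemma and the next one carry self-adjointness and positivity from
    polynomials in an operator to their norm limits. *)
Lemma selfadjoint_closed S :
  (forall e, 0 < e -> exists2 T, selfadjoint T & opnorm (T - S) <= e) -> selfadjoint S.
Proof.
move=> Scl; apply: rdot_selfadjoint => x y; apply/eqP; rewrite -subr_eq0 -normr_le0.
apply/ler_addgt0Pr => e e0; rewrite add0r; set k := rnorm x * rnorm y.
have k0 : 0 <= k by rewrite mulr_ge0 ?rnorm_ge0.
have [|T Ts TS] := Scl (e / (2 * (k + 1))); first by rewrite divr_gt0//; lra.
have TSk u v : rnorm u * rnorm v = k -> `|rdot ((T - S) u) v| <= e / 2.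
  move=> uv; apply: le_trans (rdot_op_le _ _ _) _; rewrite -mulrA uv.
  apply: le_trans (ler_wpM2r k0 TS) _.
  have -> : e / (2 * (k + 1)) * k = e / 2 * (k / (k + 1)).
    by field; rewrite gt_eqF//; lra.
  by rewrite ler_piMr ?ler_pdivrMr; lra.
have -> : rdot (S x) y - rdot x (S y) = rdot ((T - S) y) x - rdot ((T - S) x) y.
  rewrite !bopE !rdotDl !rdotNl (selfadjoint_rdot _ _ Ts) (rdotC y) (rdotC (S y)); lra.
apply: le_trans (ler_normB _ _) _.
have := TSk y x; have := TSk x y; rewrite [rnorm y * _]mulrC => /(_ erefl) + /(_ erefl).
lra.
Qed.

Lemma positive_op_closed S :
  (forall e, 0 < e -> exists2 T, positive_op T & opnorm (T - S) <= e) -> positive_op S.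
Proof.
move=> Scl.
have Ss : selfadjoint S.
  apply: selfadjoint_closed => e /Scl[T Tp TS]; exists T => //.
  exact: positive_op_selfadjoint.
apply/(positive_selfadjoint Ss) => x; apply/ler_addgt0Pr => e e0.
set k := rnorm x * rnorm x.
have k0 : 0 <= k by rewrite mulr_ge0 ?rnorm_ge0.
have [|T Tp TS] := Scl (e / (k + 1)); first by rewrite divr_gt0//; lra.
have Ts := positive_op_selfadjoint Tp.
have := rdot_op_le (T - S) x x; rewrite bopB rdotDl rdotNl -mulrA => /ler_normlW.
have := (positive_selfadjoint Ts).1 Tp x.
have : opnorm (T - S) * k <= e.
  apply: le_trans (ler_wpM2r k0 TS) _.
  by rewrite mulrAC ler_pdivrMr ?ler_pM2l; lra.
rewrite /k; lra.
Qed.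

(** The numerical radius of a self-adjoint operator bounds its norm: polarize
    at [x] and [y = S x / c], for which [rdot (S x) y] is the square of the norm
    of [S x] divided by [c]. *)
Lemma opnorm_selfadjoint S c : 0 <= c -> selfadjoint S ->
  (forall x, `|rdot (S x) x| <= c * rnorm x ^+ 2) -> opnorm S <= c.
Proof.
move=> c0 Ss Sc; apply/ler_addgt0Pr => e e0.
(* Enlarging c by e makes the division by c legitimate when c = 0. *)
have {}c0 : 0 < c + e by lra.
have {}Sc x : `|rdot (S x) x| <= (c + e) * rnorm x ^+ 2.
  by apply: le_trans (Sc x) _; rewrite ler_wpM2r ?sqr_ge0//; lra.
move: (c + e) c0 Sc => {e0}{}c c0 Sc; apply: opnorm_le => [|x]; first exact: ltW.
rewrite -(@ler_pXn2r _ 2) ?nnegrE ?mulr_ge0 ?rnorm_ge0 ?(ltW c0)//.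
set y := (c^-1)%:C *: S x.
have /ler_normlP[_ h1] := Sc (x + y); have /ler_normlP[h2 _] := Sc (x - y).
move: h1 h2; rewrite -!rdot_norm bop_appD bop_appD bop_appN !rdotDl !rdotDr.
rewrite !rdotNl !rdotNr (selfadjoint_rdot y x Ss) (rdotC y x) (rdotC y (S x)) /y.
rewrite !rdotZl !rdotZr !rdot_norm.
move=> h1 h2; have : 4 * (c^-1 * rnorm (S x) ^+ 2) <=
   2 * c * (rnorm x ^+ 2 + c^-1 * (c^-1 * rnorm (S x) ^+ 2)) by lra.
rewrite exprMn.
have ->: 2 * c * (rnorm x ^+ 2 + c^-1 * (c^-1 * rnorm (S x) ^+ 2)) = 
   2 * c^-1 * (c ^+ 2 * rnorm x ^+ 2 + rnorm (S x) ^+ 2).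
  by field; rewrite gt_eqF.
have c1 : 0 < c^-1 by rewrite invr_gt0.
rewrite mulrA -!(mulrA _ c^-1) mulrCA [leRHS]mulrCA ler_pM2l//; lra.
Qed.


(** * Completeness and the Neumann series *)

(** The limit is taken pointwise in [H]; it is linear by uniqueness of limits, and
    the Cauchy estimate, uniform on the unit ball, passes to it. *)
Lemma bop_complete (u : nat -> bop H) :
  (forall e, 0 < e -> exists N, forall n m, (N <= n)%N -> (N <= m)%N ->
     opnorm (u n - u m) <= e) ->
  exists S, forall e, 0 < e -> exists N, forall n, (N <= n)%N -> opnorm (u n - S) <= e.
Proof.
move=> ucauchy.
have ucvg x : cvg (u n x @[n --> \oo]).
  apply: cauchy_cvg; apply: cauchy_exP => e; rewrite ltcE /= => /andP[/eqP Ime Ree].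
  have xe : 0 < complex.Re e / (2 * (rnorm x + 1)).
    by rewrite divr_gt0//; have := rnorm_ge0 x; lra.
  have [N uN] := ucauchy _ xe; exists (u N x); exists N => // n /= Nn.
  rewrite -ball_normE /ball_ /= hnormE ltcE /= -Ime eqxx /=.
  rewrite -bopB; apply: le_lt_trans (opnormP _ _) _.
  apply: le_lt_trans (ler_wpM2r (rnorm_ge0 _) (uN _ _ (leqnn _) Nn)) _.
  rewrite mulrAC ltr_pdivrMr; last by have := rnorm_ge0 x; lra.
  by rewrite ltr_pM2l//; have := rnorm_ge0 x; lra.
pose L x : H := lim (u n x @[n --> \oo]).
have uL x e : 0 < e -> exists N, forall n, (N <= n)%N -> rnorm (L x - u n x) <= e.
  move=> e0; have /cvgrPdist_le := ucvg x; move=> /(_ e%:C).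
  rewrite ltcE /= eqxx e0 => /(_ isT) [N _ NL]; exists N => n /NL /=.
  by rewrite hnormE lecR.
have Lle e N : (forall n m, (N <= n)%N -> (N <= m)%N -> opnorm (u n - u m) <= e) ->
    forall n x, (N <= n)%N -> rnorm (u n x - L x) <= e * rnorm x.
  move=> uN n x Nn; apply/ler_addgt0Pr => d /(uL x)[N' uN'].
  have -> : u n x - L x = (u n - u (maxn N N')) x - (L x - u (maxn N N') x).
    by rewrite bopB opprB addrA subrK.
  apply: le_trans (ler_rnormD _ _) _; rewrite rnormN.
  apply: lerD; last by apply: uN'; rewrite leq_maxr.
  apply: le_trans (opnormP _ _) _.
  by rewrite ler_wpM2r ?rnorm_ge0// uN// leq_maxl.
have Llin : linear L.
  move=> k x y; apply/cvg_lim => //.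
  have -> : (fun n => u n (k *: x + y)) = (k \*: (u ^~ x) + (u ^~ y)).
    by apply/funext => n; rewrite bop_linear.
  by apply: cvgD; [apply: cvgZr|]; exact: ucvg.
have Lbop : L \in bop_pred (H:=H).
  apply/asboolP; split=> //.
  have [N uN] := ucauchy 1 ltr01; exists (opnorm (u N) + 1) => x.
  rewrite !hnormE -rmorphM lecR.
  have -> : L x = u N x - (u N x - L x) by rewrite subKr.
  apply: le_trans (ler_rnormD _ _) _; rewrite rnormN mulrDl lerD ?opnormP//.
  exact: Lle uN _ _ _.
exists (Bop Lbop) => e e0; have [N uN] := ucauchy _ e0; exists N => n Nn.
by apply: opnorm_le => [|x]; [exact: ltW|rewrite bopB; exact: Lle uN _ _ _].
Qed.

Definition invertible S := exists T, T * S = 1 /\ S * T = 1.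

Lemma opnorm_eq0 S : (forall e, 0 < e -> opnorm S <= e) -> S = 0.
Proof.
move=> S0; apply: bopP => x; rewrite bop0; apply/eqP; rewrite -rnorm_eq0.
rewrite eq_le rnorm_ge0 andbT; apply: le_trans (opnormP _ _) _.
have -> : opnorm S = 0; last by rewrite mul0r.
apply/le_anti; rewrite opnorm_ge0 andbT.
by apply/ler_addgt0Pr => e e0; rewrite add0r S0.
Qed.

(** The partial sums [u n] of the geometric series satisfy
    [(1 - T) * u n = 1 - T ^+ n] and form a Cauchy sequence; their limit is the
    inverse of [1 - T]. *)
Lemma neumann T : opnorm T < 1 -> invertible (1 - T).
Proof.
move=> T1; set q := opnorm T; have q0 : 0 <= q by exact: opnorm_ge0.
have opX n : opnorm (T ^+ n) <= q ^+ n.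
  elim: n => [|n IHn]; first exact: opnorm1.
  rewrite !exprS; apply: le_trans (opnormM _ _) _.
  by rewrite ler_wpM2l.
pose u n := \sum_(i < n) T ^+ i.
have uE n : (1 - T) * u n = 1 - T ^+ n.
  elim: n => [|n IHn]; first by rewrite /u big_ord0 mulr0 subrr.
  rewrite /u big_ord_recr /= mulrDr IHn mulrBl mul1r -exprS.
  by rewrite addrA subrK.
have uC n : u n * (1 - T) = (1 - T) * u n.
  rewrite /u mulr_suml mulr_sumr; apply: eq_bigr => i _.
  by rewrite mulrBl mulrBr mul1r mulr1 -exprS -exprSr.
have q1 : 0 < 1 - q by rewrite subr_gt0.
have udiff n k : opnorm (u (n + k)%N - u n) <= q ^+ n / (1 - q).
  suff : opnorm (u (n + k)%N - u n) <= q ^+ n * (1 - q ^+ k) / (1 - q).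
    move/le_trans; apply; rewrite ler_pM2r ?invr_gt0// ler_piMr ?exprn_ge0//.
    by rewrite lerBlDr lerDl exprn_ge0.
  elim: k => [|k IHk]; first by rewrite addn0 !subrr mulr0 mul0r opnorm0.
  rewrite addnS /u big_ord_recr /= -/(u _) addrAC.
  apply: le_trans (opnormD _ _) _; apply: le_trans (lerD IHk (opX _)) _.
  rewrite exprD exprSr le_eqVlt; apply/orP; left; apply/eqP; field.
  by rewrite gt_eqF.
have qcvg e : 0 < e -> exists N, forall n, (N <= n)%N -> q ^+ n <= e.
  move=> e0; have : q ^+ n @[n --> \oo] --> (0 : R).
    by apply: cvg_expr; rewrite ger0_norm.
  move=> /cvgrPdist_le/(_ e e0)[N _ NP]; exists N => n /NP /=.
  by rewrite sub0r normrN ger0_norm ?exprn_ge0.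
have [e e0|S uS] := bop_complete (u := u).
  have [|N qN] := qcvg (e * (1 - q)); first by rewrite mulr_gt0.
  have step n m : (N <= n)%N -> (n <= m)%N -> opnorm (u m - u n) <= e.
    move=> Nn /subnKC <-; apply: le_trans (udiff _ _) _.
    by rewrite ler_pdivrMr// qN.
  exists N => n m Nn Nm; have [nm|/ltnW mn] := leqP n m.
    by rewrite opnormB; exact: step.
  exact: step.
have lim_eq (A : bop H) (v : nat -> bop H) :
    (forall n, opnorm (A - v n) <= opnorm (1 - T) * opnorm (u n - S)) ->
    (forall n, v n = 1 - T ^+ n) -> A = 1.
  move=> Av vE; apply/eqP; rewrite -subr_eq0; apply/eqP; apply: opnorm_eq0 => e e0.
  set k := opnorm (1 - T); have k0 : 0 <= k by exact: opnorm_ge0.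
  have [|N uN] := uS (e / 2 / (k + 1)); first by rewrite !divr_gt0//; lra.
  have [|N' qN] := qcvg (e / 2); first by rewrite divr_gt0//; lra.
  set n := maxn N N'.
  have -> : A - 1 = (A - v n) - T ^+ n by rewrite vE -addrA -opprD subrK.
  apply: le_trans (opnormD _ _) _; rewrite opnormN.
  apply: le_trans (lerD (Av n) (opX n)) _.
  have := qN n (leq_maxr _ _).
  have : k * opnorm (u n - S) <= e / 2.
    apply: le_trans (ler_wpM2l k0 (uN _ (leq_maxl _ _))) _.
    by rewrite mulrCA ler_piMr ?ler_pdivrMr; lra.
  rewrite /k; lra.
exists S; split.
  apply: (lim_eq _ (fun n => u n * (1 - T))) => n; last by rewrite uC uE.
  by rewrite -mulrBl (opnormB (u n)) [leRHS]mulrC; exact: opnormM.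
apply: (lim_eq _ (fun n => (1 - T) * u n)) => n; last exact: uE.
by rewrite -mulrBr (opnormB (u n)); exact: opnormM.
Qed.

End Operators.

(** * Spectrum of a self-adjoint operator *)
Section Spectrum.
Context {R : realType} {H : hilbertType R}.
Implicit Types (x y z : H) (S T : bop H) (r c e : R) (p q : {poly R[i]}).

Lemma spectrumPn T (l : R[i]) : ~ spectrum T l <-> invertible (T - l *: (1 : bop H)).
Proof. by split=> [/contrapT//|Tl]; apply. Qed.

Lemma invertibleM S T : invertible S -> invertible T -> invertible (S * T).
Proof.
move=> [V [VS SV]] [W [WT TW]]; exists (W * V); split.
  by rewrite mulrA -(mulrA W) VS mulr1.
by rewrite mulrA -(mulrA S) TW mulr1.
Qed.

Lemma invertibleZ (k : R[i]) S : k != 0 -> invertible S -> invertible (k *: S).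
Proof.
move=> k0 [V [VS SV]]; exists (k^-1 *: V).
by rewrite -!bop_scalerAl -!bop_scalerAr !scalerA VS SV mulVf// mulfV// !scale1r.
Qed.

(** The inverse of a product of commuting factors yields a left inverse and a
    right inverse of each of them, and these coincide. *)
Lemma invertible_commMl S T : S * T = T * S -> invertible (S * T) -> invertible S.
Proof.
move=> ST [V [VST STV]].
have VT : V * T * S = 1 by rewrite -mulrA -ST.
have TV : S * (T * V) = 1 by rewrite mulrA.
exists (V * T); split=> //.
by have -> : V * T = T * V by rewrite -[LHS]mulr1 -TV mulrA VT mul1r.
Qed.

(** With [c = opnorm S + b], the form of [1 - S / c] takes values between [0] and
    [1 - b / c] on unit vectors, so [S / c] is inverted by the Neumann series. *)
Lemma invertible_bounded_below S b : 0 < b -> selfadjoint S ->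
  (forall x, b * rnorm x ^+ 2 <= rdot (S x) x) -> invertible S.
Proof.
move=> b0 Ss Sb; set c := opnorm S + b.
have c0 : 0 < c by have := opnorm_ge0 S; rewrite /c; lra.
have -> : S = c%:C *: (1 - (1 - (c^-1)%:C *: S)).
  by rewrite opprB addrC subrK scalerA -rmorphM mulfV ?gt_eqF// scale1r.
apply: invertibleZ; first by rewrite eq_complex /= eqxx andbT gt_eqF.
apply: neumann; apply: (@le_lt_trans _ _ (1 - b / c)); last first.
  by rewrite ltrBlDr ltrDl divr_gt0.
apply: opnorm_selfadjoint.
- rewrite subr_ge0 ler_pdivrMr// mul1r /c; have := opnorm_ge0 S; lra.
- apply: selfadjointD; first exact: selfadjoint1.
  by apply: selfadjointN; exact: selfadjointZ.
- move=> x; rewrite !bopE rdotDl rdotNl rdotZl rdot_norm.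
  have n0 : 0 <= rnorm x ^+ 2 by rewrite sqr_ge0.
  have := rdot_op_le S x x; rewrite -mulrA -expr2 => /ler_normlW Sx.
  have Sc : c^-1 * rdot (S x) x <= rnorm x ^+ 2.
    rewrite mulrC ler_pdivrMr// mulrC /c mulrDl; apply: le_trans Sx _.
    by rewrite lerDl mulr_ge0// ltW.
  have bS : c^-1 * (b * rnorm x ^+ 2) <= c^-1 * rdot (S x) x.
    by rewrite ler_pM2l ?invr_gt0.
  rewrite ger0_norm ?subr_ge0// mulrBl mul1r lerB//.
  by rewrite mulrAC mulrC.
Qed.

(** For [l = a + i b] the product of [T - l] and [T - l^*] is
    [(T - a) ^ 2 + b ^ 2], which is bounded below by [b ^ 2]. *)
Lemma selfadjoint_spectrum_real T l : selfadjoint T -> spectrum T l -> complex.Im l = 0.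
Proof.
move=> Ts Tl; apply/eqP/negPn/negP => b0; apply: Tl.
case: l b0 => a b /= b0; set l := (a +i* b)%C.
pose W := T * T + (- (2 * a))%:C *: T + (a ^+ 2 + b ^+ 2)%:C *: (1 : bop H).
have WE (l1 l2 : R[i]) : l1 + l2 = (2 * a)%:C -> l1 * l2 = (a ^+ 2 + b ^+ 2)%:C ->
    (T - l1 *: (1 : bop H)) * (T - l2 *: (1 : bop H)) = W.
  move=> lD lM; rewrite mulrBl !mulrBr -!bop_scalerAl -!bop_scalerAr !mul1r mulr1.
  rewrite scalerA lM opprB /W rmorphN /= -lD scaleNr scalerDl opprD -!addrA.
  by apply: (congr1 (+%R (T * T))); rewrite [LHS]addrA [RHS]addrC.
have lD : l + l^*%C = (2 * a)%:C.
  by apply/eqP; rewrite eq_complex /= subrr eqxx andbT mulr_natl mulr2n.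
have lM : l * l^*%C = (a ^+ 2 + b ^+ 2)%:C.
  by apply/eqP; rewrite eq_complex /= -!expr2 mulrN opprK eqxx/= mulrN addrC mulrC subrr.
have W1 := WE _ _ lD lM; rewrite addrC in lD; rewrite mulrC in lM.
have W2 := WE _ _ lD lM.
apply: (@invertible_commMl _ (T - l^*%C *: (1 : bop H))); rewrite W1 ?W2//.
apply: (@invertible_bounded_below _ (b ^+ 2)); first by rewrite exprn_even_gt0.
- apply: selfadjointD; [apply: selfadjointD|].
  + by rewrite -expr2; exact: selfadjointX.
  + exact: selfadjointZ.
  + by apply: selfadjointZ; exact: selfadjoint1.
- move=> x; rewrite !bopE !rdotDl !rdotZl (selfadjoint_rdot _ _ Ts) !rdot_norm.
  have : 0 <= rdot (T x - a%:C *: x) (T x - a%:C *: x) by rewrite rdot_norm sqr_ge0.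
  rewrite rdotDl !rdotDr !rdotNl !rdotNr !rdotZl !rdotZr (rdotC x) !rdot_norm; lra.
Qed.

(** A weak form of the Cauchy-Schwarz inequality for the form of [P], obtained
    from its positivity at [x - P x / c]. *)
Lemma positive_op_sq P c x : positive_op P -> 0 < c -> opnorm P <= c ->
  rnorm (P x) ^+ 2 <= c * rdot (P x) x.
Proof.
move=> Pp c0 Pc; have Ps := positive_op_selfadjoint Pp.
have := (positive_selfadjoint Ps).1 Pp (x - (c^-1)%:C *: P x).
rewrite bop_appD bop_appN bop_appZ !rdotDl !rdotDr !rdotNl !rdotNr !rdotZl !rdotZr.
rewrite (selfadjoint_rdot (P x) x Ps) !rdot_norm => h.
have := rdot_op_le P (P x) (P x); rewrite -mulrA -expr2 => /ler_normlW h2.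
have {h2}h2 : rdot (P (P x)) (P x) <= c * rnorm (P x) ^+ 2.
  by apply: le_trans h2 _; rewrite ler_wpM2r ?sqr_ge0.
have c1 : 0 < c^-1 by rewrite invr_gt0.
have : c^-1 * (c^-1 * rdot (P (P x)) (P x)) <= c^-1 * rnorm (P x) ^+ 2.
  by rewrite ler_pM2l// mulrC ler_pdivrMr// mulrC.
move=> h3; rewrite -ler_pdivrMl//; lra.
Qed.

(** Let [a] be the infimum of the numerical range of [S] and suppose [a < 0].
    Then [P = S - a] is positive and invertible, and [positive_op_sq] bounds the
    square of the norm of [P x] by a multiple of [rdot (P x) x].  Invertibility
    bounds it from below by a multiple of the square of the norm of [x], so that
    [a + d] is still a lower bound for some [d > 0]. *)
Lemma positive_op_spectrum S : selfadjoint S ->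
  (forall l : R, l < 0 -> invertible (S - l%:C *: (1 : bop H))) -> positive_op S.
Proof.
move=> Ss Sinv; apply/(positive_selfadjoint Ss) => x0; rewrite leNgt; apply/negP => Sx0.
have x00 : 0 < rnorm x0 ^+ 2.
  rewrite exprn_gt0// rnorm_gt0; apply/eqP => x00.
  by move: Sx0; rewrite x00 bop_app0 /rdot linear0l ltxx.
pose E : set R := [set r | forall x, r * rnorm x ^+ 2 <= rdot (S x) x].
have Eub x : 0 < rnorm x ^+ 2 -> ubound E (rdot (S x) x / rnorm x ^+ 2).
  by move=> x1 r Er; rewrite ler_pdivlMr.
have E0 : E !=set0.
  exists (- opnorm S) => x; have := rdot_op_le S x x.
  by rewrite -mulrA -expr2 => /ler_normlP[+ _]; lra.
pose a := sup E.
have Esup : has_sup E by split=> //; exists (rdot (S x0) x0 / rnorm x0 ^+ 2); exact: Eub.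
have Ea : E a.
  move=> x; have [x1|] := ltP 0 (rnorm x ^+ 2).
    by rewrite -ler_pdivlMr//; apply: ge_sup => //; exact: Eub.
  rewrite le_eqVlt ltNge sqr_ge0 orbF sqrf_eq0 rnorm_eq0 => /eqP ->.
  by rewrite rnorm0 bop_app0 /rdot linear0l expr0n mulr0.
have a0 : a < 0.
  apply: (@le_lt_trans _ _ (rdot (S x0) x0 / rnorm x0 ^+ 2)).
    by apply: ge_sup => //; exact: Eub.
  by rewrite ltr_pdivrMr// mul0r.
set P := S - a%:C *: (1 : bop H).
have PE x : rdot (P x) x = rdot (S x) x - a * rnorm x ^+ 2.
  by rewrite !bopE rdotDl rdotNl rdotZl rdot_norm.
have Pp : positive_op P.
  apply/positive_selfadjoint => [|x]; last by rewrite PE subr_ge0; exact: Ea.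
  apply: selfadjointD => //; apply: selfadjointN; apply: selfadjointZ; exact: selfadjoint1.
have [V [VP PV]] := Sinv _ a0; rewrite -/P in VP PV.
set v := opnorm V; set c := opnorm P + 1.
have c0 : 0 < c by have := opnorm_ge0 P; rewrite /c; lra.
have vc0 : 0 <= v ^+ 2 * c by rewrite mulr_ge0 ?sqr_ge0 ?ltW.
pose d := (v ^+ 2 * c + 1)^-1.
have d0 : 0 < d by rewrite invr_gt0; lra.
have : E (a + d).
  move=> x; rewrite mulrDl addrC -lerBrDr -PE.
  rewrite /d mulrC ler_pdivrMr; last by lra.
  have xV : x = V (P x) by rewrite -bopM VP.
  have : rnorm x ^+ 2 <= v ^+ 2 * rnorm (P x) ^+ 2.
    rewrite -exprMn lerXn2r ?nnegrE ?mulr_ge0 ?rnorm_ge0 ?opnorm_ge0//.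
    by rewrite {1}xV opnormP.
  move/le_trans; apply.
  rewrite mulrDr mulr1; apply: (@le_trans _ _ (rdot (P x) x * (v ^+ 2 * c))).
    rewrite [leRHS]mulrCA ler_wpM2l ?sqr_ge0// [leRHS]mulrC.
    by apply: positive_op_sq => //; rewrite /c; lra.
  rewrite lerDl; apply: (positive_selfadjoint _).1 => //.
  exact: positive_op_selfadjoint.
by move=> /(ub_le_sup Esup.2); rewrite -/a; lra.
Qed.

(** If the real spectrum were empty, then [S - k] would be positive for every
    [k], in particular for [k = opnorm S + 1], which is impossible at
    [x != 0]. *)
Lemma spectrum_nonempty S x : selfadjoint S -> x != 0 -> exists r, spectrum S r%:C.
Proof.
move=> Ss x0; apply: contrapT => /forallNP noS.
set k := opnorm S + 1.
have Sk : selfadjoint (S - k%:C *: (1 : bop H)).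
  apply: selfadjointD => //; apply: selfadjointN; apply: selfadjointZ; exact: selfadjoint1.
have : positive_op (S - k%:C *: (1 : bop H)).
  apply: positive_op_spectrum => // l _.
  by rewrite -addrA -opprD -scalerDl -rmorphD; apply/spectrumPn/noS.
move=> /(positive_selfadjoint Sk)/(_ x).
rewrite !bopE rdotDl rdotNl rdotZl rdot_norm subr_ge0 leNgt => /negP; apply.
have := rdot_op_le S x x; rewrite -mulrA -expr2 => /ler_normlW Sx.
apply: le_lt_trans Sx _; rewrite ltr_pM2r ?exprn_gt0 ?rnorm_gt0//.
by rewrite /k ltrDl.
Qed.

(** * Polynomials in an operator *)

(** [op_horner] with complex coefficients: the factorization into linear factors
    takes place over [R[i]]. *)
Definition bop_horner p T := \sum_(i < size p) p`_i *: T ^+ i.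

Lemma bop_hornerE p T n : (size p <= n)%N -> bop_horner p T = \sum_(i < n) p`_i *: T ^+ i.
Proof.
move=> pn; rewrite /bop_horner (big_ord_widen _ (fun i => p`_i *: T ^+ i) pn) big_mkcond.
apply: eq_bigr => i _; case: ltnP => // /(nth_default 0) ->.
by rewrite scale0r.
Qed.

Lemma bop_hornerD p q T : bop_horner (p + q) T = bop_horner p T + bop_horner q T.
Proof.
set n := maxn (size p) (size q).
rewrite !(@bop_hornerE _ _ n) ?leq_maxl ?leq_maxr ?size_polyD// -big_split.
by apply: eq_bigr => i _; rewrite coefD scalerDl.
Qed.

Lemma bop_hornerZ (k : R[i]) p T : bop_horner (k *: p) T = k *: bop_horner p T.
Proof.
rewrite (@bop_hornerE _ _ (size p)) ?size_scale_leq// scaler_sumr.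
by apply: eq_bigr => i _; rewrite coefZ scalerA.
Qed.

Lemma bop_hornerC (k : R[i]) T : bop_horner k%:P T = k *: (1 : bop H).
Proof.
by rewrite (@bop_hornerE _ _ 1) ?size_polyC_leq1// big_ord1 coefC eqxx expr0.
Qed.

Lemma bop_hornerMX p T : bop_horner (p * 'X) T = bop_horner p T * T.
Proof.
rewrite (@bop_hornerE _ _ (size p).+1); last first.
  by apply: leq_trans (size_polyMleq _ _) _; rewrite size_polyX addn2.
rewrite big_ord_recl coefMX /= scale0r add0r mulr_suml.
by apply: eq_bigr => i _; rewrite coefMX /= -bop_scalerAl -exprSr.
Qed.

Lemma bop_hornerX T : bop_horner 'X T = T.
Proof. by rewrite -['X]mul1r bop_hornerMX bop_hornerC scale1r mul1r. Qed.

Lemma bop_hornerM p q T : bop_horner (p * q) T = bop_horner p T * bop_horner q T.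
Proof.
elim/poly_ind: q => [|q c IHq]; first by rewrite mulr0 -polyC0 bop_hornerC scale0r mulr0.
rewrite mulrDr mulrA !bop_hornerD !bop_hornerMX IHq mulrDr mulrA bop_hornerC.
by rewrite -bop_scalerAr mulr1 mulrC mul_polyC bop_hornerZ.
Qed.

Lemma bop_horner_comp p q T : bop_horner (p \Po q) T = bop_horner p (bop_horner q T).
Proof.
elim/poly_ind: p => [|p c IHp]; first by rewrite comp_poly0 -polyC0 !bop_hornerC !scale0r.
by rewrite comp_poly_MXaddC !bop_hornerD bop_hornerMX !bop_hornerC bop_hornerM IHp.
Qed.

End Spectrum.

Section Calculus.
Context {R : realType} {H : hilbertType R}.
Implicit Types (x : H) (S T : bop H) (r c e : R) (p q : {poly R}) (f g : R -> R).

Lemma op_hornerE p T : op_horner p T = bop_horner (map_poly (real_complex R) p) T.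
Proof.
rewrite /bop_horner size_map_poly; apply: eq_bigr => i _.
by rewrite coef_map.
Qed.

Lemma op_hornerD p q T : op_horner (p + q) T = op_horner p T + op_horner q T.
Proof. by rewrite !op_hornerE rmorphD bop_hornerD. Qed.

Lemma op_hornerZ r p T : op_horner (r *: p) T = r%:C *: op_horner p T.
Proof. by rewrite !op_hornerE map_polyZ bop_hornerZ. Qed.

Lemma op_hornerB p q T : op_horner (p - q) T = op_horner p T - op_horner q T.
Proof. by rewrite -scaleN1r op_hornerD op_hornerZ rmorphN1 scaleN1r. Qed.

Lemma op_hornerC r T : op_horner r%:P T = r%:C *: (1 : bop H).
Proof. by rewrite op_hornerE map_polyC bop_hornerC. Qed.

Lemma op_hornerX T : op_horner 'X T = T.
Proof. by rewrite op_hornerE map_polyX bop_hornerX. Qed.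

Lemma op_horner_comp p q T : op_horner (p \Po q) T = op_horner p (op_horner q T).
Proof. by rewrite !op_hornerE map_comp_poly bop_horner_comp. Qed.

Lemma op_horner_selfadjoint p T : selfadjoint T -> selfadjoint (op_horner p T).
Proof.
by move=> Ts; apply: selfadjoint_sum => i; apply: selfadjointZ; exact: selfadjointX.
Qed.

Lemma invertible_zero_space S : (forall x, x = 0) -> invertible S.
Proof. by move=> x0; exists 0; split; apply: bopP => x; rewrite [RHS]x0 [LHS]x0. Qed.

(** By factorization, the value of [p] at [T] is a product of the operators
    [T - z] over the roots [z] of [p]. *)
Lemma bop_horner_invertible (p : {poly R[i]}) T : p != 0 ->
  (forall z, root p z -> invertible (T - z *: (1 : bop H))) -> invertible (bop_horner p T).
Proof.
have [r ->] := closed_field_poly_normal p.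
set k := lead_coef p; clearbody k => kr0.
have k0 : k != 0 by apply: contraNneq kr0 => ->; rewrite scale0r.
move=> rT; rewrite bop_hornerZ; apply: invertibleZ => //.
have {}rT z : z \in r -> invertible (T - z *: (1 : bop H)).
  by move=> zr; apply: rT; rewrite rootZ// root_prod_XsubC.
elim: r rT {kr0} => [|z r IHr] rT.
  by rewrite big_nil -polyC1 bop_hornerC scale1r; exists 1; rewrite mul1r.
rewrite big_cons bop_hornerM; apply: invertibleM.
  by rewrite -polyCN bop_hornerD bop_hornerX bop_hornerC scaleNr; apply: rT; exact: mem_head.
by apply: IHr => y yr; apply: rT; rewrite in_cons yr orbT.
Qed.

(** For [l < 0], a root [z] of [p - l] in the spectrum of [T] would be real,
    hence satisfy [0 <= p.[z] = l]; so [p(T) - l] is invertible.  The polynomial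
    [p - l] vanishes identically only if [p] is the constant [l], which is
    excluded by [spectrum_nonempty] unless [H] is trivial. *)
Lemma op_horner_ge0 p T : selfadjoint T ->
  (forall s : R, spectrum T s%:C -> 0 <= p.[s]) -> positive_op (op_horner p T).
Proof.
move=> Ts p0; apply: positive_op_spectrum => [|l l0]; first exact: op_horner_selfadjoint.
have [[x x0]|] := pselect (exists x : H, x != 0); last first.
  move=> /forallNP H0; apply: invertible_zero_space => x.
  by have /negP := H0 x; rewrite negbK => /eqP.
rewrite -(op_hornerC l T) -op_hornerB op_hornerE; apply: bop_horner_invertible.
  rewrite map_poly_eq0 subr_eq0; apply/eqP => pl.
  have [s /p0] := spectrum_nonempty Ts x0.
  by rewrite pl hornerC leNgt l0.
move=> z pz; apply/spectrumPn => Tz.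
have z0 := selfadjoint_spectrum_real Ts Tz.
have zE : z = (complex.Re z)%:C by rewrite [LHS]complexE z0 rmorph0 mulr0 addr0.
rewrite zE in pz Tz; move: pz; rewrite /root horner_map hornerD hornerN hornerC.
rewrite fmorph_eq0 subr_eq0 => /eqP pz.
by have := p0 _ Tz; rewrite pz leNgt l0.
Qed.

Lemma positive_opD S T : positive_op S -> positive_op T -> positive_op (S + T).
Proof. by move=> Sp Tp x; rewrite bopD linearDl; exact: addr_ge0 (Sp x) (Tp x). Qed.

Lemma le_op_trans S T V : le_op S T -> le_op T V -> le_op S V.
Proof.
by rewrite /le_op => ST TV; rewrite -(subrK T V) -addrA; exact: positive_opD.
Qed.

(** [op_horner_ge0] for [c - p] and [c + p] bounds the numerical radius of
    [p(T)]. *)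
Lemma op_horner_norm p T c : selfadjoint T -> 0 <= c ->
  (forall s : R, spectrum T s%:C -> `|p.[s]| <= c) -> opnorm (op_horner p T) <= c.
Proof.
move=> Ts c0 pc; have ps := op_horner_selfadjoint p Ts.
apply: opnorm_selfadjoint => // x.
have h1 : positive_op (op_horner (c%:P - p) T).
  apply: op_horner_ge0 => // s /pc; rewrite !hornerE => /ler_normlW; lra.
have h2 : positive_op (op_horner (c%:P + p) T).
  by apply: op_horner_ge0 => // s /pc /ler_normlP[]; rewrite !hornerE; lra.
have := (positive_selfadjoint (positive_op_selfadjoint h1)).1 h1 x.
have := (positive_selfadjoint (positive_op_selfadjoint h2)).1 h2 x.
rewrite op_hornerB op_hornerD op_hornerC !bopE !rdotDl rdotNl rdotZl rdot_norm.
by rewrite ler_norml; lra.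
Qed.

(** Spectral mapping: [T - s] is a factor of [p(T) - p(s)] that commutes with its
    cofactor, so it is invertible as soon as [p(T) - p(s)] is. *)
Lemma spectrum_horner p T (s : R) :
  spectrum T s%:C -> spectrum (op_horner p T) (p.[s])%:C.
Proof.
move=> Ts; apply: contrapT => /spectrumPn; rewrite -(op_hornerC _ T) -op_hornerB.
have [q ->] : exists q, p - (p.[s])%:P = ('X - s%:P) * q.
  have /factor_theorem[q ->] : root (p - (p.[s])%:P) s.
    by rewrite /root hornerD hornerN hornerC subrr.
  by exists q; rewrite mulrC.
rewrite op_hornerE rmorphM /= bop_hornerM => inv; apply: Ts.
have <- : bop_horner (map_poly (real_complex R) ('X - s%:P)) T = T - s%:C *: (1 : bop H).
  by rewrite -op_hornerE op_hornerB op_hornerX op_hornerC.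
by apply: (invertible_commMl _ inv); rewrite -!bop_hornerM mulrC.
Qed.

(** For [s < a] the operator [T - s] is bounded below by [a - s], and for [s > b]
    the operator [s - T] is bounded below by [s - b]. *)
Lemma spectrum_bounds T a b : positive_op (T - a%:C *: (1 : bop H)) ->
  positive_op (b%:C *: (1 : bop H) - T) ->
  forall s : R, spectrum T s%:C -> s \in `[a, b].
Proof.
have rE r x : rdot ((r%:C *: (1 : bop H)) x) x = r * rnorm x ^+ 2.
  by rewrite !bopE rdotZl rdot_norm.
have sr r : selfadjoint (r%:C *: (1 : bop H)) by apply: selfadjointZ; exact: selfadjoint1.
move=> Ta bT s Ts.
have Tas := positive_op_selfadjoint Ta.
have bTs := positive_op_selfadjoint bT.
rewrite in_itv/=; apply/andP; split; rewrite leNgt; apply/negP => sab; apply: Ts.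
  apply: (@invertible_bounded_below _ _ _ (a - s)); first by rewrite subr_gt0.
    rewrite -(subrK (a%:C *: (1 : bop H)) T) -addrA.
    by apply: selfadjointD => //; apply: selfadjointD => //; exact: selfadjointN.
  move=> x; have := (positive_selfadjoint Tas).1 Ta x.
  by rewrite !bopB !rdotDl !rdotNl !rE; lra.
have -> : T - s%:C *: (1 : bop H) = (-1) *: (s%:C *: (1 : bop H) - T).
  by rewrite scaleN1r opprB.
apply: invertibleZ; first by rewrite oppr_eq0 oner_eq0.
apply: (@invertible_bounded_below _ _ _ (s - b)); first by rewrite subr_gt0.
  rewrite -(subrKA (b%:C *: (1 : bop H))).
  by apply: selfadjointD => //; apply: selfadjointD => //; exact: selfadjointN.
move=> x; have := (positive_selfadjoint bTs).1 bT x.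
by rewrite !bopB !rdotDl !rdotNl !rE; lra.
Qed.

(** * The continuous functional calculus *)

(** The uniform convergence of a sequence of polynomials in [is_cfc] is traded for
    the existence of one good approximation at each precision. *)
Lemma is_cfcP T f S : is_cfc T f S <-> forall e, 0 < e -> exists2 p : {poly R},
  (forall s : R, spectrum T s%:C -> `|f s - p.[s]| <= e) &
  opnorm (op_horner p T - S) <= e.
Proof.
split=> [[p [pf pS]] e e0|TfS].
  have /pf[N1 _ N1P] : nbhs (f : {uniform` [set s : R | spectrum T s%:C] -> R})
      [set h | forall s : R, spectrum T s%:C -> `|f s - h s| <= e].
    apply/uniform_nbhs; exists [set xy : R * R | `|xy.1 - xy.2| < e]; split.
      by rewrite -entourage_from_ballE; exists e => //= -[x y] /=; rewrite -ball_normE.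
    by move=> h /= hE s /hE /ltW.
  have /cvgrPdist_le/(_ e e0)[N2 _ N2P] := pS.
  exists (p (maxn N1 N2)); first by apply: N1P; rewrite /= leq_maxl.
  have := N2P (maxn N1 N2); rewrite /= leq_maxr sub0r normrN ger0_norm ?opnorm_ge0//.
  exact.
have en n : 0 < n.+1%:R^-1 :> R by rewrite invr_gt0.
pose p n := sval (cid2 (TfS _ (en n))).
have pf n : forall s : R, spectrum T s%:C -> `|f s - (p n).[s]| <= n.+1%:R^-1.
  by rewrite /p; case: (cid2 _).
have pS n : opnorm (op_horner (p n) T - S) <= n.+1%:R^-1.
  by rewrite /p; case: (cid2 _).
have small e : 0 < e -> \forall n \near \oo, n.+1%:R^-1 < e.
  by move=> e0; exact: near_infty_natSinv_lt (PosNum e0).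
exists p; split.
  move=> W /uniform_nbhs[E [entE EW]].
  move: entE; rewrite -entourage_from_ballE => -[e /= e0 eE].
  near=> n; apply: EW => s /= Ts; apply: eE => /=.
  rewrite -ball_normE /=; apply: le_lt_trans (pf n s Ts) _.
  by near: n; exact: small.
apply/cvgrPdist_le => e e0; near=> n.
rewrite sub0r normrN ger0_norm ?opnorm_ge0//; apply: le_trans (pS n) _.
by apply: ltW; near: n; exact: small.
Unshelve. all: by end_near.
Qed.

(** If [p] and [q] approximate [f] and [g] up to [e / 4], then [q - p + e / 2] is
    nonnegative on the spectrum, hence takes a positive value at [T], and
    this value is at distance at most [e] from [V - S]. *)
Lemma is_cfc_le T f g S V : selfadjoint T -> is_cfc T f S -> is_cfc T g V ->
  (forall s : R, spectrum T s%:C -> f s <= g s) -> le_op S V.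
Proof.
move=> Ts /is_cfcP TfS /is_cfcP TgV fg; apply: positive_op_closed => e e0.
have e4 : 0 < e / 4 by lra.
have [p pf pS] := TfS _ e4; have [q qg qV] := TgV _ e4.
exists (op_horner (q - p + (e / 2)%:P) T).
  apply: op_horner_ge0 => // s sT; rewrite !hornerE.
  have := pf s sT; have := qg s sT; have := fg s sT.
  by move=> ? /ler_normlP[? ?] /ler_normlP[? ?]; lra.
rewrite op_hornerD op_hornerB op_hornerC.
have -> : op_horner q T - op_horner p T + (e / 2)%:C *: (1 : bop H) - (V - S) =
    ((op_horner q T - V) - (op_horner p T - S)) + (e / 2)%:C *: (1 : bop H).
  by rewrite addrAC !opprB addrACA [X in _ = X + _]addrACA (addrC (- V)).
apply: le_trans (opnormD _ _) _; apply: le_trans (lerD (opnormD _ _) (opnormZ_le _ _)) _.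
rewrite opnormN ger0_norm; last by lra.
have : e / 2 * opnorm (1 : bop H) <= e / 2 by rewrite ler_piMr ?opnorm1//; lra.
lra.
Qed.

Lemma is_cfc_horner T p : is_cfc T (fun s => p.[s]) (op_horner p T).
Proof.
apply/is_cfcP => e e0; exists p; last by rewrite subrr opnorm0 ltW.
by move=> s _; rewrite subrr normr0 ltW.
Qed.

(** By spectral mapping, an approximation [q] of [g] on the spectrum of [p(T)]
    yields the approximation [q \Po p] of [g \o p] on the spectrum of [T]. *)
Lemma is_cfc_comp T p g S :
  is_cfc (op_horner p T) g S -> is_cfc T (fun s => g p.[s]) S.
Proof.
move=> /is_cfcP gS; apply/is_cfcP => e /gS[q qg qS]; exists (q \Po p).
  by move=> s /(spectrum_horner (p := p))/qg; rewrite horner_comp.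
by rewrite op_horner_comp.
Qed.

Lemma is_cfcZ T r f S : is_cfc T f S -> is_cfc T (fun s => r * f s) (r%:C *: S).
Proof.
move=> /is_cfcP fS; apply/is_cfcP => e e0.
have r1 : 0 < `|r| + 1 by have := normr_ge0 r; lra.
have er : `|r| * (e / (`|r| + 1)) <= e.
  by rewrite mulrCA ler_piMr ?(ltW e0)// ler_pdivrMr// mul1r lerDl.
have [|p pf pS] := fS (e / (`|r| + 1)); first by rewrite divr_gt0.
exists (r *: p) => [s /pf sf|].
  rewrite hornerZ -mulrBr normrM; apply: le_trans er.
  by rewrite ler_wpM2l.
rewrite op_hornerZ -scalerBr; apply: le_trans (opnormZ_le _ _) _.
by apply: le_trans er; rewrite ler_wpM2l.
Qed.

(** By [op_horner_norm] the values at [T] of a uniformly Cauchy sequence of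
    polynomials form a Cauchy sequence of operators. *)
Lemma is_cfc_exists T f : selfadjoint T ->
  (forall e, 0 < e -> exists p : {poly R},
     forall s : R, spectrum T s%:C -> `|f s - p.[s]| <= e) ->
  exists S, is_cfc T f S.
Proof.
move=> Ts fappr.
have en n : 0 < n.+1%:R^-1 :> R by rewrite invr_gt0.
pose p n := sval (cid (fappr _ (en n))).
have pf n : forall s : R, spectrum T s%:C -> `|f s - (p n).[s]| <= n.+1%:R^-1.
  by rewrite /p; case: (cid _).
have small e : 0 < e -> exists N, forall n, (N <= n)%N -> n.+1%:R^-1 <= e.
  by move=> e0; have [N _ NP] := near_infty_natSinv_lt (PosNum e0); exists N => n /NP /ltW.
have [e e0|S pS] := bop_complete (u := fun n => op_horner (p n) T).
  have [|N NP] := small (e / 2); first by lra.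
  exists N => n m Nn Nm; rewrite -op_hornerB.
  apply: op_horner_norm => //; first exact: ltW.
  move=> s sT; rewrite !hornerE.
  have -> : (p n).[s] - (p m).[s] = (f s - (p m).[s]) - (f s - (p n).[s]) by lra.
  apply: le_trans (ler_normB _ _) _.
  rewrite (splitr e); apply: lerD.
    by apply: le_trans (pf m s sT) (NP m Nm).
  by apply: le_trans (pf n s sT) (NP n Nn).
exists S; apply/is_cfcP => e e0.
have [N NP] := pS e e0; have [N' NP'] := small e e0.
exists (p (maxn N N')); last by apply: NP; rewrite leq_maxl.
by move=> s /pf/le_trans; apply; apply: NP'; rewrite leq_maxr.
Qed.

End Calculus.

(** * Weierstrass approximation *)
Section Weierstrass.
Context {R : realType}.
Implicit Types (x y a b c d e : R) (f : R -> R) (g h : nat -> R).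

(** The polynomial [\sum_(k < n.+1) 'C(n, k)%:R * g k *: ('X ^+ k * (1 - 'X) ^+ (n - k))],
    the expectation of [g] under the binomial law with parameter ['X].
    The recursion conditions on one trial, so that monotonicity and moments are
    obtained by induction on [n]. *)
Fixpoint bernstein (n : nat) g : {poly R} :=
  if n is n'.+1 then 'X * bernstein n' (g \o S) + (1 - 'X) * bernstein n' g
  else (g 0%N)%:P.

Lemma bernsteinS n g x : (bernstein n.+1 g).[x] =
  x * (bernstein n (g \o S)).[x] + (1 - x) * (bernstein n g).[x].
Proof. by rewrite /= !hornerE. Qed.

Lemma bernstein_le n g h x : 0 <= x <= 1 -> (forall k, (k <= n)%N -> g k <= h k) ->
  (bernstein n g).[x] <= (bernstein n h).[x].
Proof.
move=> /andP[x0 x1]; elim: n g h => [|n IHn] g h gh; first by rewrite /= !hornerC gh.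
rewrite !bernsteinS lerD// ler_wpM2l ?subr_ge0//; apply: IHn => k kn /=; apply: gh => //.
exact: leqW.
Qed.

(** The mean of the binomial law is [n x] and its variance [n x (1 - x)]. *)
Lemma bernstein_sqr n a c d x :
  (bernstein n (fun k => c + d * (k%:R - a) ^+ 2)).[x] =
  c + d * (n%:R * (x * (1 - x)) + (n%:R * x - a) ^+ 2).
Proof.
elim: n a => [|n IHn] a; first by rewrite /= hornerC; ring.
rewrite bernsteinS IHn.
have -> : (fun k : nat => c + d * (k%:R - a) ^+ 2) \o S =
    (fun k : nat => c + d * (k%:R - (a - 1)) ^+ 2).
  by apply/funext => k /=; rewrite -natr1; ring.
by rewrite IHn -natr1; ring.
Qed.

(** Heine-Cantor, from the covering form of the compactness of [[a, b]]: near each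
    point, all small enough [d] are suitable. *)
Lemma uniform_modulus a b f e : {within `[a, b], continuous f} -> 0 < e ->
  exists2 d, 0 < d & forall u v, u \in `[a, b] -> v \in `[a, b] ->
    `|u - v| < d -> `|f u - f v| <= e.
Proof.
move=> /subspace_continuousP fc e0.
pose P d (u : R) := u \in `[a, b] -> forall v, v \in `[a, b] ->
  `|u - v| < d -> `|f u - f v| <= e.
have [d d0 dP] : \forall d \near 0^'+, `[a, b]%classic `<=` P d.
  apply: (compact_near_coveringP _).1; first exact: segment_compact.
  move=> x xab.
have e2 : 0 < e / 2 by lra.
  have /cvgrPdist_le/(_ _ e2) := fc x xab.
  rewrite near_withinE => -[r /= r0 rP].
  exists (ball x (r / 2), [set d | d < r / 2]) => /=.
    split; first by apply: nbhsx_ballx; lra.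
    by apply: nbhs_right_lt; lra.
  move=> [u d] /= [xu dr] uab v vab uv.
  move: xu; rewrite -ball_normE /= => xu.
  have fu : `|f x - f u| <= e / 2.
    by apply: rP => //=; rewrite ?in_itv//; apply: lt_trans xu _; lra.
  have fv : `|f x - f v| <= e / 2.
    apply: rP => //=.
    have -> : x - v = (x - u) + (u - v) by lra.
    by apply: le_lt_trans (ler_normD _ _) _; lra.
  have -> : f u - f v = (f x - f v) - (f x - f u) by lra.
  by apply: le_trans (ler_normB _ _) _; lra.
exists (d / 2); first by rewrite divr_gt0.
  move=> u v uab vab uv; apply: (dP (d / 2)) => //=.
    by rewrite sub0r normrN ger0_norm; rewrite /= in d0; lra.
  by rewrite /= in d0; lra.
Qed.

(** The shape of the modulus needed by Bernstein polynomials, whose action on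
    squares is explicit.  Points at distance at least [d] are covered by the
    bound [2 k] on the oscillation of [f]. *)
Lemma quadratic_modulus a b f e : a <= b -> {within `[a, b], continuous f} -> 0 < e ->
  exists2 c, 0 <= c & forall u v, u \in `[a, b] -> v \in `[a, b] ->
    `|f u - f v| <= e + c * (u - v) ^+ 2.
Proof.
move=> ab fc e0; have [d d0 fd] := uniform_modulus fc e0.
have [k [k0 fk]] : exists k, 0 <= k /\ forall u, u \in `[a, b] -> `|f u| <= k.
  have [u1 _ fu1] := EVT_max ab fc; have [u2 _ fu2] := EVT_min ab fc.
  exists (`|f u1| + `|f u2|); split=> [|u uab]; first by rewrite addr_ge0.
  rewrite ler_norml; have := fu1 u uab; have := fu2 u uab.
  have := ler_norm (f u1); have := normr_ge0 (f u1).
  have := ler_norm (- f u2); rewrite normrN; have := normr_ge0 (f u2); lra.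
exists (2 * k / d ^+ 2); first by rewrite divr_ge0 ?sqr_ge0//; lra.
move=> u v uab vab; have [uv|uv] := ltP `|u - v| d.
  apply: le_trans (fd u v uab vab uv) _.
  by rewrite lerDl mulr_ge0 ?sqr_ge0// divr_ge0 ?sqr_ge0//; lra.
apply: le_trans (ler_normB _ _) _.
have : 2 * k <= 2 * k / d ^+ 2 * (u - v) ^+ 2.
  rewrite mulrAC ler_pdivlMr ?exprn_gt0// ler_wpM2l//; first by lra.
  by rewrite -(real_normK (num_real (u - v))) lerXn2r ?nnegrE ?(ltW d0).
by have := fk u uab; have := fk v vab; lra.
Qed.

(** By [quadratic_modulus], [f] at the node of index [k] differs from [f s] by at
    most [e / 2] plus a multiple of the square of [k - n x].  The Bernstein
    polynomial averages the latter to the variance [n x (1 - x)], which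
    contributes at most [c (b - a) ^ 2 / n]. *)
Lemma weierstrass a b f e : a < b -> {within `[a, b], continuous f} -> 0 < e ->
  exists p : {poly R}, forall s, s \in `[a, b] -> `|f s - p.[s]| <= e.
Proof.
move=> ab fc e0; have e2 : 0 < e / 2 by lra.
have [c c0 fm] := quadratic_modulus (ltW ab) fc e2.
have ba : 0 < b - a by rewrite subr_gt0.
have ba2 : 0 <= c * (b - a) ^+ 2 by rewrite mulr_ge0 ?sqr_ge0.
pose n := (Num.truncn (c * (b - a) ^+ 2 / (e / 2))).+1.
have n0 : 0 < n%:R :> R by rewrite ltr0n.
have nc : c * (b - a) ^+ 2 / n%:R <= e / 2.
  rewrite ler_pdivrMr// -ler_pdivrMl// [leLHS]mulrC; apply: ltW.
  exact: truncnS_gt.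
clearbody n.
pose node (k : nat) := a + (b - a) * (k%:R / n%:R).
exists (bernstein n (f \o node) \Po ((b - a)^-1 *: ('X - a%:P))) => s sab.
rewrite horner_comp !hornerE; set x := (b - a)^-1 * (s - a).
have sx : s = a + (b - a) * x by rewrite /x; field; rewrite gt_eqF.
have x01 : 0 <= x <= 1.
  move: sab; rewrite in_itv /= /x => /andP[sa sb].
  by rewrite ler_pdivrMl// ler_pdivlMl// mulr0 mulr1 subr_ge0 sa lerD2r.
have nodein k : (k <= n)%N -> node k \in `[a, b].
  move=> kn; rewrite in_itv /= /node lerDl mulr_ge0 ?divr_ge0 ?(ltW ba)//=.
  by rewrite -lerBrDl ler_piMr ?(ltW ba)// ler_pdivrMr// mul1r ler_nat.
pose w := c * (b - a) ^+ 2 / n%:R ^+ 2.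
have nodeE k : (k <= n)%N -> `|f s - f (node k)| <= e / 2 + w * (k%:R - n%:R * x) ^+ 2.
  move=> kn; apply: le_trans (fm _ _ sab (nodein _ kn)) _.
  rewrite lerD2l sx /node /w le_eqVlt; apply/orP; left; apply/eqP; field.
  by rewrite gt_eqF.
have wx : w * (n%:R * (x * (1 - x)) + (n%:R * x - n%:R * x) ^+ 2) <= e / 2.
  rewrite subrr expr0n addr0; apply: le_trans nc.
  have -> : w * (n%:R * (x * (1 - x))) = (c * (b - a) ^+ 2 / n%:R) * (x * (1 - x)).
    by rewrite /w; field; rewrite gt_eqF.
  by rewrite ler_piMr ?divr_ge0 ?(ltW n0)//; case/andP: x01 => x0 x1; nra.
have up : (bernstein n (f \o node)).[x] <=
    (bernstein n (fun k => (f s + e / 2) + w * (k%:R - n%:R * x) ^+ 2)).[x].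
  by apply: bernstein_le => // k /nodeE /ler_normlP[? ?] /=; lra.
have lo : (bernstein n (fun k => (f s - e / 2) + (- w) * (k%:R - n%:R * x) ^+ 2)).[x] <=
    (bernstein n (f \o node)).[x].
  by apply: bernstein_le => // k /nodeE /ler_normlP[? ?] /=; lra.
by move: up lo; rewrite !bernstein_sqr => up lo; rewrite ler_norml; lra.
Qed.

End Weierstrass.

(** * Chords, convexity and positive maps *)
Section Main.
Context {R : realType}.

Lemma cfcP (H : hilbertType R) (a b : R) (T : bop H) (f : R -> R) : a < b ->
  selfadjoint T -> (forall s : R, spectrum T s%:C -> s \in `[a, b]) ->
  {within `[a, b], continuous f} -> is_cfc T f (cfc T f).
Proof.
move=> ab Ts Tab fc; have [|S TfS] := is_cfc_exists (f := f) Ts.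
  move=> e e0; have [p pf] := weierstrass ab fc e0.
  by exists p => s /Tab/pf.
exact: (@xgetPex _ 0 [set B | is_cfc T f B] (ex_intro _ S TfS)).
Qed.

Lemma positive_map_le (H K : hilbertType R) (Phi : {linear bop H -> bop K}) S T :
  positive_map Phi -> le_op S T -> le_op (Phi S) (Phi T).
Proof. by move=> Pp ST; rewrite /le_op -linearB; exact: Pp. Qed.

Lemma convex_chord (a b : R) (f : R -> R) s : a < b ->
  convex_function (`[a, b]%classic : set R) f -> s \in `[a, b] ->
  f s <= (b - s) / (b - a) * f a + (s - a) / (b - a) * f b.
Proof.
move=> ab fc; rewrite in_itv/= => /andP[as_ sb].
have ba : 0 < b - a by rewrite subr_gt0.
have w0 : 0 <= (b - s) / (b - a) by rewrite divr_ge0 ?subr_ge0// ltW.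
have w1 : (b - s) / (b - a) <= 1 by rewrite ler_pdivrMr// mul1r; lra.
have {}fc := fc (Itv01 w0 w1) a b; rewrite convRE [X in f X <= _]convRE /= in fc.
move: fc.
rewrite !inE /= !in_itv /= !lexx (ltW ab) => /(_ isT isT).
have -> : unstable.onem ((b - s) / (b - a)) = (s - a) / (b - a).
  by rewrite /unstable.onem; field; rewrite gt_eqF.
suff -> : (b - s) / (b - a) * a + (s - a) / (b - a) * b = s by [].
by field; rewrite gt_eqF.
Qed.

Lemma powR_chord (p x y v w : R) : 1 <= p -> 0 <= x -> 0 <= y -> 0 <= v -> v + w = 1 -> 0 <= w ->
  (v * x + w * y) `^ p <= v * x `^ p + w * y `^ p.
Proof.
move=> p1 x0 y0 v0 vw w0; have v1 : v <= 1 by lra.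
have -> : w = unstable.onem v by rewrite /unstable.onem; lra.
have cvx := convex_powR p1 (Itv01 v0 v1) (x := x) (y := y).
rewrite convRE [X in X `^ _ <= _]convRE /= in cvx.
by apply: cvx; rewrite inE /= in_itv /= andbT.
Qed.

Lemma powR_within_continuous (p a b : R) : 0 < a ->
  {within `[a, b], continuous (fun s : R => s `^ p)}.
Proof.
move=> a0; apply: derivable_within_continuous => x; rewrite in_itv/= => /andP[ax _].
by apply: derivable_powR; rewrite in_itv/= andbT; apply: lt_le_trans ax.
Qed.

(** The extreme value theorem ensures that [set_max] does not take its default
    value. *)
Lemma set_max_ub (a b : R) (f : R -> R) s : a <= b -> {within `[a, b], continuous f} ->
  s \in `[a, b] -> f s <= set_max [set f s | s in `[a, b]].
Proof.
move=> ab fc sab; set E := [set f s | s in `[a, b]].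
have [c cab fmax] := EVT_max ab fc.
have ex : exists x, [set x | E x /\ ubound E x] x.
  by exists (f c); split; [exists c | move=> _ [r rab <-]; exact: fmax].
by have [_] := xgetPex 0 ex; apply; exists s.
Qed.

Lemma within_continuousV (A : set R) (f : R -> R) :
  (forall s, A s -> f s != 0) ->
  {within A, continuous f} -> {within A, continuous (fun s => (f s)^-1)}.
Proof.
move=> f0 /subspace_continuousP fc; apply/subspace_continuousP => x Ax.
by apply: cvgV; [exact: f0|exact: fc].
Qed.

Lemma within_continuousM (A : set R) (f g : R -> R) :
  {within A, continuous f} -> {within A, continuous g} ->
  {within A, continuous (fun s => f s * g s)}.
Proof.
move=> /subspace_continuousP fc /subspace_continuousP gc.
by apply/subspace_continuousP => x Ax; apply: cvgM; [exact: fc|exact: gc].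
Qed.

(** The affine function with value [u] at [a] and [v] at [b], in the form in which
    it is evaluated at an operator. *)
Definition chord (a b u v : R) : {poly R} :=
  u *: ((b - a)^-1 *: (b%:P - 'X)) + v *: ((b - a)^-1 *: ('X - a%:P)).

Lemma chordE (a b u v s : R) :
  (chord a b u v).[s] = (b - s) / (b - a) * u + (s - a) / (b - a) * v.
Proof. by rewrite /chord !(hornerD, hornerN, hornerZ, hornerX, hornerC); ring. Qed.

Lemma op_horner_chord (H : hilbertType R) (a b u v : R) (T : bop H) :
  op_horner (chord a b u v) T =
  u%:C *: ((b - a)^-1%:C *: (b%:C *: (1 : bop H) - T))
  + v%:C *: ((b - a)^-1%:C *: (T - a%:C *: (1 : bop H))).
Proof. by rewrite op_hornerD !op_hornerZ !op_hornerB !op_hornerX !op_hornerC. Qed.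

(** Unital linear maps commute with affine functions; this is what replaces the
    multiplicativity that [Phi] lacks. *)
Lemma unital_map_chord (H K : hilbertType R) (Phi : {linear bop H -> bop K})
    (a b u v : R) (T : bop H) : unital_map Phi ->
  Phi (op_horner (chord a b u v) T) = op_horner (chord a b u v) (Phi T).
Proof.
have PhiD (S S' : bop H) : Phi (S + S') = Phi S + Phi S' by exact: raddfD.
have PhiB (S S' : bop H) : Phi (S - S') = Phi S - Phi S' by exact: raddfB.
have PhiZ (k : R[i]) (S : bop H) : Phi (k *: S) = k *: Phi S by exact: linearZ.
by move=> Phi1; rewrite !op_horner_chord PhiD !PhiZ !PhiB !PhiZ Phi1.
Qed.

Lemma chord_bounds (a b u v s : R) : a < b -> s \in `[a, b] ->
  Num.min u v <= (chord a b u v).[s] <= Num.max u v.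
Proof.
move=> ab; rewrite in_itv/= => /andP[as_ sb]; rewrite chordE.
have ba : 0 < b - a by rewrite subr_gt0.
have w0 : 0 <= (b - s) / (b - a) by rewrite divr_ge0 ?subr_ge0// ltW.
have w1 : 0 <= (s - a) / (b - a) by rewrite divr_ge0 ?subr_ge0// ltW.
have w01 : (b - s) / (b - a) + (s - a) / (b - a) = 1 by field; rewrite gt_eqF.
move: (_ / _) ((s - a) / _) w0 w1 w01 => w w' w0 w1 w01.
by case: (leP u v) => uv; apply/andP; split; nra.
Qed.

Lemma spectrum_horner_bounds (H : hilbertType R) (T : bop H) (p : {poly R}) (a b : R) :
  selfadjoint T ->
  (forall s : R, spectrum T s%:C -> a <= p.[s] <= b) ->
  forall s : R, spectrum (op_horner p T) s%:C -> s \in `[a, b].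
Proof.
move=> Ts pab; apply: spectrum_bounds; rewrite -(op_hornerC _ T) -op_hornerB;
  by apply: op_horner_ge0 => // s /pab /andP[]; rewrite !hornerE; lra.
Qed.

End Main.

Theorem corollary2p5 (R : realType) (H K : hilbertType R) (m M : R)
    (hmM : m < M) (A : bop H) (hA : selfadjoint A)
    (hsp : spectrum A `<=` [set s%:C | s in `[m, M]])
    (Phi : {linear bop H -> bop K})
    (hpos : positive_map Phi) (hunit : unital_map Phi)
    (t : R) (ht : 0 < t < 1) (f : R -> R)
    (fpos : forall s, s \in `[m, M] -> 0 < f s)
    (fcont : {within `[m, M], continuous f})
    (fconv : convex_function (`[m, M]%classic : set R)
               (fun s : R => f s `^ t)) :
  let B := (f m `^ t)%:C *: ((M - m)^-1%:C *: (M%:C *: (1 : bop H) - A))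
         + (f M `^ t)%:C *: ((M - m)^-1%:C *: (A - m%:C *: (1 : bop H))) in
  let alpha := set_max
    [set (f s)^-1 * ((M - s) / (M - m) * f m + (s - m) / (M - m) * f M)
      | s in `[m, M]] in
  le_op (Phi (cfc A f)) (Phi (cfc B (fun s => s `^ (1 / t)))) /\
  le_op (Phi (cfc B (fun s => s `^ (1 / t))))
        (alpha%:C *: cfc (Phi A) f).
Proof.
move=> B alpha.
have [t0 t1] := andP ht.
have mI : m \in `[m, M] by rewrite in_itv /= lexx ltW.
have MI : M \in `[m, M] by rewrite in_itv /= lexx ltW.
have [fm0 fM0] := (fpos m mI, fpos M MI).
have spA s : spectrum A s%:C -> s \in `[m, M].
  by move=> /hsp[r rI /complexI <-].
set u := f m `^ t; set v := f M `^ t.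
have u0 : 0 < u by exact: powR_gt0.
have v0 : 0 < v by exact: powR_gt0.
set L := chord m M u v; set N := chord m M (f m) (f M).
have BE : B = op_horner L A by rewrite op_horner_chord.
pose g := fun s : R => s `^ (1 / t).
have tK x : 0 < x -> g (x `^ t) = x.
  by move=> x0; rewrite /g -powRrM mul1r mulfV ?gt_eqF// powRr1 ?ltW.
have lo0 : 0 < Num.min u v by rewrite lt_min u0 v0.
(* The spectrum of B lies between the minimum and the maximum of u and v; halving
   the minimum gives a nondegenerate interval even when u = v. *)
have gB : is_cfc A (fun s => g L.[s]) (cfc B g).
  apply: is_cfc_comp; rewrite -BE.
  apply: (cfcP (a := Num.min u v / 2) (b := Num.max u v)).
  - have : Num.min u v <= Num.max u v by rewrite ge_min le_max lexx.
    lra.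
  - by rewrite BE; exact: op_horner_selfadjoint.
  - rewrite BE; apply: spectrum_horner_bounds => // s /spA sI.
    by have /andP[] := chord_bounds u v hmM sI; lra.
  - by apply: powR_within_continuous; lra.
have scalar_sa r : selfadjoint (r%:C *: (1 : bop K)).
  by apply: selfadjointZ; exact: selfadjoint1.
have lowA : positive_op (Phi A - m%:C *: (1 : bop K)).
  rewrite -hunit -linearZ -linearB; apply: hpos.
  rewrite -(op_hornerC _ A) -[X in X - _](op_hornerX A) -op_hornerB.
  by apply: op_horner_ge0 => // s /spA; rewrite in_itv /= !hornerE subr_ge0 => /andP[].
have uppA : positive_op (M%:C *: (1 : bop K) - Phi A).
  rewrite -hunit -linearZ -linearB; apply: hpos.
  rewrite -(op_hornerC _ A) -[X in _ - X](op_hornerX A) -op_hornerB.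
  by apply: op_horner_ge0 => // s /spA; rewrite in_itv /= !hornerE subr_ge0 => /andP[].
have sPhiA : selfadjoint (Phi A).
  rewrite -(subrK (m%:C *: (1 : bop K)) (Phi A)).
  by apply: selfadjointD => //; exact: positive_op_selfadjoint.
have spPhiA := spectrum_bounds lowA uppA.
(* First inequality: the chord of f ^ t lies above f ^ t. *)
split.
  apply: positive_map_le => //; apply: is_cfc_le hA (cfcP hmM hA spA fcont) gB _.
  move=> s /spA sI; rewrite -[leLHS]tK ?fpos// /g.
  rewrite ge0_ler_powR ?nnegrE ?powR_ge0 ?divr_ge0 ?(ltW t0)//.
  - have /andP[+ _] := chord_bounds u v hmM sI; apply: le_trans; exact: ltW.
  - by rewrite chordE; exact: (convex_chord hmM fconv sI).
(* Second inequality, through N(A): L(s) ^ (1 / t) <= N(s) by convexity of the power. *)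
apply: le_op_trans (positive_map_le hpos _) _.
  apply: is_cfc_le hA gB (is_cfc_horner A N) _ => s /spA sI.
  have := sI; rewrite in_itv/= => /andP[ms sM].
  have Mm : 0 < M - m by rewrite subr_gt0.
  rewrite !chordE -(tK (f m) fm0) -(tK (f M) fM0); apply: powR_chord.
  - by rewrite div1r invf_ge1 ?(ltW t1).
  - exact: ltW.
  - exact: ltW.
  - by rewrite divr_ge0 ?subr_ge0// ltW.
  - by field; rewrite gt_eqF.
  - by rewrite divr_ge0 ?subr_ge0// ltW.
(* It remains to compare N with alpha f on the spectrum of Phi(A). *)
rewrite unital_map_chord//.
apply: is_cfc_le sPhiA (is_cfc_horner _ _) (is_cfcZ _ (cfcP hmM sPhiA spPhiA fcont)) _.
move=> s /spPhiA sI; rewrite -ler_pdivrMr ?fpos// mulrC chordE.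
pose h s := (f s)^-1 * ((M - s) / (M - m) * f m + (s - m) / (M - m) * f M).
apply: (@set_max_ub _ _ _ h) => //; first exact: ltW.
apply: within_continuousM.
  by apply: within_continuousV => // r /fpos /gt_eqF ->.
apply: continuous_subspaceT => r.
have -> : (fun s => (M - s) / (M - m) * f m + (s - m) / (M - m) * f M) = horner N.
  by apply/funext => x; rewrite chordE.
exact: continuous_horner.
Qed.
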